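(* Let $1\le p\le q<s<\infty$ and $1\le r\le s$ be real numbers, let $U,X$ be Banach spaces and $T\in\mathcal{L}(U;X)$. The following are equivalent: (i) $T\in\mathcal{W}^{A}_{(s,q,r;p)}(U;X)$; (ii) $\Psi_{x^*}\circ T\in\Pi_{q,p}(U;\ell_s)$ for all $x^*=(x^*_k)_{k=1}^\infty \in B_{\ell_r(X^* )}$. Moreover, if (i) is true (and therefore both statements are), then $$w^{A}_{(s,q,r;p)}(T) = \sup_{x^*\in B_{\ell_r(X^* )}}\pi_{q,p}\left( \Psi_{x^*}\circ T\right).$$
   Context: Banach spaces are over $\mathbb{K}=\mathbb{R}$ or $\mathbb{C}$; $B_X$ is the closed unit ball of $X$, $X^*$ its topological dual, $\mathcal{L}(U;X)$ the space of continuous linear operators. $\ell_p(X)$ is the space of absolutely $p$-summable $X$-valued sequences with its usual norm $\|\cdot\|_p$, and $\ell_p^w(X)$ the space of weakly $p$-summable ones with norm $\|(x_j)_j\|_{w,p}=\sup_{x^*\in B_{X^*}}\|(x^*(x_j))_{j}\|_p$. $\Pi_{q,p}(U;Y)$ is the space of absolutely $(q;p)$-summing operators, i.e. those $S\in\mathcal{L}(U;Y)$ for which there is $C\ge0$ with $\|(S(u_j))_{j}\|_q\le C\|(u_j)_{j}\|_{w,p}$ for all $(u_j)_j\in\ell_p^w(U)$; $\pi_{q,p}(S)$ is the least such $C$. For $x^*=(x_k^* )_{k=1}^\infty\in\ell_r(X^* )$, $\Psi_{x^*}:X\to\ell_s$ is the continuous linear operator $\Psi_{x^*}(x)=(x_k^*(x))_{k=1}^\infty$.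 The space $\ell^{A}_{(s,q,r)}(X)$ consists of all sequences $(x_j)_{j=1}^\infty$ in $X$ such that $\sum_{j=1}^\infty\left(\sum_{k=1}^\infty|x_k^*(x_j)|^s\right)^{q/s}<\infty$ for every $(x_k^* )_{k=1}^\infty\in\ell_r(X^* )$. $\mathcal{W}^{A}_{(s,q,r;p)}(U;X)$ is the class of weakly anisotropic $(s,q,r;p)$-summing operators, i.e. those $T\in\mathcal{L}(U;X)$ such that $(T(u_j))_{j=1}^\infty\in\ell^{A}_{(s,q,r)}(X)$ whenever $(u_j)_{j=1}^\infty\in\ell_p^w(U)$. Its norm $w^{A}_{(s,q,r;p)}(T)$ is the infimum of all $D>0$ such that $$\left( \sum_{j=1}^\infty \left( \sum_{k=1}^\infty \left| x^*_k( T(u_j)) \right|^s \right)^{\frac{q}{s}} \right)^{\frac{1}{q}} \leq D \left\| (x^*_k)_{k=1}^\infty \right\|_r \left\| (u_j)_{j=1}^\infty \right\|_{w,p}$$ for all $(u_j)_{j=1}^\infty\in\ell_p^w(U)$ and $(x_k^* )_{k=1}^\infty\in\ell_r(X^* )$. *)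

(* Defs.v *)
From HB Require Import structures.
From mathcomp Require Import all_boot all_order all_algebra.
From mathcomp Require Import complex.
From mathcomp Require Import all_classical all_reals all_analysis.

Set Implicit Arguments.
Unset Strict Implicit.
Unset Printing Implicit Defensive.

Import Order.TTheory GRing.Theory Num.Theory.
Import numFieldNormedType.Exports.

Local Open Scope classical_set_scope.
Local Open Scope ring_scope.

Variant scalars := RealScalars | ComplexScalars.

Definition scalar_field (R : realType) (k : scalars) : numFieldType :=
  match k with
  | RealScalars => R : numFieldType
  | ComplexScalars => R[i] : numFieldType
  end.

(* In MathComp-Analysis the norm of a normed space over K takes its values in
   K itself; [to_real] and [of_real] move norms between K and R. *)
Definition to_real (R : realType) (k : scalars) : scalar_field R k -> R :=
  match k with
  | RealScalars => id
  | ComplexScalars => @complex.Re R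
  end.

Definition of_real (R : realType) (k : scalars) : R -> scalar_field R k :=
  match k with
  | RealScalars => id
  | ComplexScalars => fun a => (a%:C)%C
  end.

Section scalars_theory.
Variables (R : realType) (k : scalars).
Local Notation K := (scalar_field R k).
Implicit Types (a b : R) (x y : K).

Lemma of_realK : cancel (@of_real R k) (@to_real R k).
Proof. by case: k. Qed.

Lemma to_realK x : 0 <= x -> of_real k (to_real x) = x.
Proof.
by case: k x => //= -[u v]; rewrite lecE /= => /andP[/eqP -> _].
Qed.

Lemma of_realD a b : of_real k (a + b) = of_real k a + of_real k b.
Proof. by case: k => //=; rewrite rmorphD. Qed.

Lemma of_realM a b : of_real k (a * b) = of_real k a * of_real k b.
Proof. by case: k => //=; rewrite rmorphM. Qed.

Lemma of_real0 : of_real k (0 : R) = 0.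
Proof. by case: k. Qed.

Lemma of_real1 : of_real k (1 : R) = 1.
Proof. by case: k. Qed.

Lemma ler_of_real a b : (of_real k a <= of_real k b) = (a <= b).
Proof. by case: k => //=; exact: lecR. Qed.

End scalars_theory.

Definition rnorm (R : realType) (k : scalars)
  (V : normedModType (scalar_field R k)) (x : V) : R := to_real `|x|.

Section rnorm_theory.
Variables (R : realType) (k : scalars).
Local Notation K := (scalar_field R k).
Variable V : normedModType K.
Implicit Types x y : V.

Lemma of_real_rnorm x : of_real k (rnorm x) = `|x|.
Proof. by rewrite to_realK. Qed.

Lemma rnorm_ge0 x : 0 <= rnorm x.
Proof. by rewrite -(ler_of_real k) of_real_rnorm of_real0. Qed.

Lemma rnorm0 : rnorm (0 : V) = 0.
Proof. by rewrite /rnorm normr0 -(of_real0 R k) of_realK. Qed.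

Lemma rnorm_eq0 x : rnorm x = 0 -> x = 0.
Proof. by move=> x0; apply/normr0_eq0; rewrite -of_real_rnorm x0 of_real0. Qed.

Lemma rnormD x y : rnorm (x + y) <= rnorm x + rnorm y.
Proof. by rewrite -(ler_of_real k) of_realD !of_real_rnorm ler_normD. Qed.

End rnorm_theory.

Lemma rnormZ (R : realType) (k : scalars)
    (V : normedModType (scalar_field R k)) (l : scalar_field R k) (x : V) :
  rnorm (l *: x) = rnorm (l : (scalar_field R k)^o) * rnorm x.
Proof.
apply: (can_inj (@of_realK R k)).
by rewrite of_realM (of_real_rnorm (l : (scalar_field R k)^o)) !of_real_rnorm normrZ.
Qed.

(* [clin U V] is the space of continuous linear operators from U to V; it is
   made a normed space with the operator norm below. *)
Section clin.
Variables (R : realType) (k : scalars).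
Local Notation K := (scalar_field R k).
Variables U V : normedModType K.

Definition clin_pred : {pred (U -> V)} :=
  mem [set f : U -> V | linear f /\ continuous f].

Record clin := Clin { clin_val :> U -> V ; _ : clin_val \in clin_pred }.

HB.instance Definition _ := [isSub for clin_val].
HB.instance Definition _ := [Choice of clin by <:].

Lemma clin_linear (f : clin) : linear f.
Proof. by have := valP f; rewrite inE => -[]. Qed.

Lemma clin_continuous (f : clin) : continuous f.
Proof. by have := valP f; rewrite inE => -[]. Qed.

HB.instance Definition _ (f : clin) :=
  GRing.isLinear.Build K U V _ (clin_val f) (clin_linear f).

Lemma clin_submod_closed : submod_closed clin_pred.
Proof.
split.
  rewrite inE; split; last exact: cst_continuous.
  by move=> a x y /=; rewrite scaler0 addr0.
move=> a f g; rewrite !inE => -[lf cf] [lg cg]; split.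
  move=> b x y; rewrite /= !fctE /= lf lg !scalerDr !scalerA.
  by rewrite [a * b]mulrC addrACA.
move=> x; apply: continuousD; last exact: cg.
by apply: continuousZl_tmp; exact: cf.
Qed.

HB.instance Definition _ := GRing.isSubmodClosed.Build _ _ clin_pred
  clin_submod_closed.
HB.instance Definition _ := [SubChoice_isSubLmodule of clin by <:].
End clin.

Section clin_norm.
Variables (R : realType) (k : scalars).
Local Notation K := (scalar_field R k).
Variables U V : normedModType K.
Implicit Types (f g : clin U V) (u : U).

Definition opnorm f : R := sup [set rnorm (f u) | u in [set u | rnorm u <= 1]].

Lemma clin_bounded f : exists2 M : R, 0 <= M &
  forall u, rnorm (f u) <= M * rnorm u.
Proof.
have /continuous_linear_bounded/linear_boundedP : {for 0, continuous f}.
  exact: clin_continuous.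
case/pinfty_ex_gt0 => r r0 fr.
have Er : of_real k (to_real r) = r by rewrite to_realK// ltW.
exists (to_real r) => [|u].
  by rewrite -(ler_of_real k) Er of_real0 ltW.
rewrite -(ler_of_real k) of_realM Er !of_real_rnorm; exact: fr.
Qed.

Lemma opnorm_has_sup f :
  has_sup [set rnorm (f u) | u in [set u | rnorm u <= 1]].
Proof.
split.
  by exists (rnorm (f 0)), 0 => //=; rewrite rnorm0.
have [M M0 fM] := clin_bounded f; exists M => _ [u /= u1 <-].
by rewrite (le_trans (fM u))// ler_piMr.
Qed.

Lemma opnorm_ub f u : rnorm u <= 1 -> rnorm (f u) <= opnorm f.
Proof.
by move=> u1; apply: sup_upper_bound; [exact: opnorm_has_sup|exists u].
Qed.

Lemma opnorm_le f (M : R) :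
  (forall u, rnorm u <= 1 -> rnorm (f u) <= M) -> opnorm f <= M.
Proof.
move=> fM; apply: ge_sup; first by have [] := opnorm_has_sup f.
by move=> _ [u /= u1 <-]; exact: fM.
Qed.

Lemma opnorm_ge0 f : 0 <= opnorm f.
Proof.
by apply: le_trans (opnorm_ub f (u := 0) _); rewrite ?rnorm_ge0// rnorm0.
Qed.

Lemma rnorm_of_real (a : R) : 0 <= a -> rnorm (of_real k a : K^o) = a.
Proof.
move=> a0; rewrite /rnorm ger0_norm ?of_realK//.
by rewrite -(of_real0 R k) ler_of_real.
Qed.

Lemma rnorm_clin f u : rnorm (f u) <= opnorm f * rnorm u.
Proof.
have [u0|u0] := eqVneq (rnorm u) 0.
  by rewrite (rnorm_eq0 u0) linear0 !rnorm0 mulr0.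
have u_gt0 : 0 < rnorm u by rewrite lt_def u0 rnorm_ge0.
rewrite -ler_pdivrMr// mulrC.
have Ei : rnorm (of_real k (rnorm u)^-1 : K^o) = (rnorm u)^-1.
  by rewrite rnorm_of_real// invr_ge0 ltW.
rewrite -[X in X * _]Ei -rnormZ -linearZ; apply: opnorm_ub.
by rewrite rnormZ Ei mulVf.
Qed.

Lemma opnormD f g : opnorm (f + g) <= opnorm f + opnorm g.
Proof.
apply: opnorm_le => u u1; rewrite (le_trans (rnormD _ _))//.
by rewrite lerD// opnorm_ub.
Qed.

Lemma opnormZ (a : K) f : opnorm (a *: f) = rnorm (a : K^o) * opnorm f.
Proof.
have le b g : opnorm (b *: g) <= rnorm (b : K^o) * opnorm g.
  apply: opnorm_le => u u1; rewrite rnormZ ler_wpM2l ?rnorm_ge0//.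
  exact: opnorm_ub.
apply/eqP; rewrite eq_le le /=.
have [->|a0] := eqVneq a 0; first by rewrite rnorm0 mul0r opnorm_ge0.
have na0 : 0 < rnorm (a : K^o).
  rewrite lt_def rnorm_ge0 andbT; apply: contra a0 => /eqP/rnorm_eq0 a0.
  exact/eqP.
rewrite -ler_pdivlMl// -{1}[f](scalerK a0) (le_trans (le _ _))//.
rewrite ler_wpM2r ?opnorm_ge0//.
rewrite -[leRHS]mul1r ler_pdivlMr// -rnormZ.
have -> : a^-1 *: (a : K^o) = 1 by rewrite /GRing.scale /= mulVf.
by rewrite /rnorm normr1 -(of_real1 R k) of_realK.
Qed.

Definition clin_norm f : K := of_real k (opnorm f).

Lemma clin_normD f g : clin_norm (f + g) <= clin_norm f + clin_norm g.
Proof. by rewrite -of_realD ler_of_real opnormD. Qed.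

Lemma clin_normZ (a : K) f : clin_norm (a *: f) = `|a| * clin_norm f.
Proof. by rewrite /clin_norm opnormZ of_realM (of_real_rnorm (a : K^o)). Qed.

Lemma clin_norm_eq0 f : clin_norm f = 0 -> f = 0.
Proof.
rewrite -(of_real0 R k) => /(can_inj (@of_realK R k)) f0.
apply/val_inj/funext => u; apply: rnorm_eq0; apply/eqP.
by rewrite eq_le rnorm_ge0 andbT (le_trans (rnorm_clin f u))// f0 mul0r.
Qed.

HB.instance Definition _ := Lmodule_isNormed.Build K (clin U V)
  clin_normD clin_normZ clin_norm_eq0.

Lemma rnorm_clinE f : rnorm f = opnorm f.
Proof. by rewrite /rnorm of_realK. Qed.
End clin_norm.

Definition dual (R : realType) (k : scalars)
    (X : normedModType (scalar_field R k)) : normedModType (scalar_field R k) :=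
  clin X (scalar_field R k)^o.

Section clin_comp.
Variables (R : realType) (k : scalars).
Variables U V W : normedModType (scalar_field R k).

Lemma clin_comp_subproof (S : clin V W) (T : clin U V) :
  S \o T \in @clin_pred R k U W.
Proof.
rewrite inE; split => [a x y|x] /=; first by rewrite !linearP.
by apply: continuous_comp; exact: clin_continuous.
Qed.

Definition clin_comp (S : clin V W) (T : clin U V) : clin U W :=
  Clin (clin_comp_subproof S T).
End clin_comp.

Section lp.
Variables (R : realType) (k : scalars).
Local Notation K := (scalar_field R k).

(* [+oo] exactly when the sequence is not absolutely p-summable *)
Definition lp_enorm (X : normedModType K) (p : R) (x : nat -> X) : \bar R :=
  ((\sum_(0 <= j <oo) (rnorm (x j) `^ p)%:E) `^ p^-1)%E.

Variables (p : R) (p1 : 1 <= p) (X : normedModType K).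
Implicit Types x y : nat -> X.

Let p_gt0 : 0 < p. Proof. exact: lt_le_trans p1. Qed.

Lemma lp_enorm_ge0 x : (0 <= lp_enorm p x)%E.
Proof. exact: poweR_ge0. Qed.

Let rsum_ge0 x :
  (0 <= \sum_(0 <= j <oo) (rnorm (x j) `^ p)%:E)%E.
Proof. by apply: nneseries_ge0 => j _ _; rewrite lee_fin powR_ge0. Qed.

Let lp_Lnorm (a : nat -> R) : (forall j, 0 <= a j) ->
  ((\sum_(0 <= j <oo) (a j `^ p)%:E) `^ p^-1 =
    Lnorm counting p%:E (EFin \o a))%E.
Proof.
move=> a0; rewrite Lnorm_counting//; congr poweR.
by apply: eq_eseriesr => j _; rewrite /= ger0_norm.
Qed.

Lemma lp_enormD x y :
  (lp_enorm p (fun j => x j + y j)%R <= lp_enorm p x + lp_enorm p y)%E.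
Proof.
rewrite /lp_enorm !lp_Lnorm; try by move=> j; exact: rnorm_ge0.
have := @minkowski_EFin _ _ _ (@counting nat R)
  (fun j => rnorm (x j)) (fun j => rnorm (y j)) p _ _ p1.
move=> /(_ ltac:(by []) ltac:(by [])); apply: le_trans.
rewrite -!lp_Lnorm; try by move=> j /=; rewrite ?addr_ge0 ?rnorm_ge0.
apply: gt0_ler_poweR; rewrite ?invr_ge0 ?(ltW p_gt0)//.
- by rewrite in_itv /= leey andbT rsum_ge0.
- rewrite in_itv /= leey andbT; apply: nneseries_ge0 => j _ _.
  by rewrite lee_fin powR_ge0.
apply: lee_nneseries => [j _ _|j _]; rewrite lee_fin ?powR_ge0//=.
apply: ge0_ler_powR; rewrite ?nnegrE ?addr_ge0 ?rnorm_ge0 ?rnormD//.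
exact: ltW.
Qed.

Lemma lp_enormZ (a : K) x :
  lp_enorm p (fun j => a *: x j) = ((rnorm (a : K^o))%:E * lp_enorm p x)%E.
Proof.
rewrite /lp_enorm (eq_eseriesr (g := fun j =>
  ((rnorm (a : K^o) `^ p)%:E * (rnorm (x j) `^ p)%:E)%E)); last first.
  by move=> j _; rewrite rnormZ powRM ?rnorm_ge0.
rewrite nneseriesZl; last by move=> j _; rewrite lee_fin powR_ge0.
rewrite poweRM ?lee_fin ?powR_ge0// poweR_EFin -powRrM mulfV ?gt_eqF//.
by rewrite powRr1 ?rnorm_ge0.
Qed.

Lemma lp_enorm0 : lp_enorm p (fun=> 0 : X) = 0%E.
Proof.
by rewrite /lp_enorm eseries0 ?poweR0r ?invr_neq0 ?gt_eqF// => j _ _;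
  rewrite rnorm0 powR0// gt_eqF.
Qed.

Lemma rnorm_le_lp_enorm x j : ((rnorm (x j))%:E <= lp_enorm p x)%E.
Proof.
have -> : (rnorm (x j))%:E = ((rnorm (x j) `^ p)%:E `^ p^-1)%E.
  by rewrite poweR_EFin -powRrM mulfV ?gt_eqF// powRr1 ?rnorm_ge0.
apply: gt0_ler_poweR; rewrite ?invr_ge0 ?(ltW p_gt0)//.
- by rewrite in_itv /= leey andbT lee_fin powR_ge0.
- by rewrite in_itv /= leey andbT rsum_ge0.
rewrite (nneseriesD1 (n := j))//; last by move=> i _; rewrite lee_fin powR_ge0.
rewrite leeDl//; apply: nneseries_ge0 => i _ _.
by rewrite lee_fin powR_ge0.
Qed.

Definition lp_pred : {pred (nat -> X)} :=
  mem [set x : nat -> X | (lp_enorm p x < +oo)%E].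

Lemma lp_submod_closed : submod_closed lp_pred.
Proof.
split; first by rewrite inE /= lp_enorm0 ltry.
move=> a x y; rewrite !inE /= => xp yp.
apply: le_lt_trans (lp_enormD (fun j => a *: x j) y) _.
rewrite lp_enormZ lte_add_pinfty//.
by rewrite lte_mul_pinfty ?lee_fin ?rnorm_ge0.
Qed.
End lp.

Section lp_space.
Variables (R : realType) (k : scalars).
Local Notation K := (scalar_field R k).
Variables (p : R) (X : normedModType K).

Record lp (p1 : 1 <= p) :=
  Lp { lp_val :> nat -> X ; _ : lp_val \in @lp_pred R k p X }.

Variable p1 : 1 <= p.

HB.instance Definition _ := [isSub for (@lp_val p1)].
HB.instance Definition _ := [Choice of lp p1 by <:].
HB.instance Definition _ := GRing.isSubmodClosed.Build _ _ (@lp_pred R k p X)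
  (@lp_submod_closed R k p p1 X).
HB.instance Definition _ := [SubChoice_isSubLmodule of lp p1 by <:].

Implicit Types x y : lp p1.

Lemma lp_enorm_lty x : (lp_enorm p x < +oo)%E.
Proof. by have := valP x; rewrite inE. Qed.

Definition lp_norm x : R := fine (lp_enorm p x).

Lemma lp_normE x : (lp_norm x)%:E = lp_enorm p x.
Proof. by rewrite fineK// ge0_fin_numE ?lp_enorm_ge0// lp_enorm_lty. Qed.

Definition lp_knorm x : K := of_real k (lp_norm x).

Lemma lp_knormD x y : lp_knorm (x + y) <= lp_knorm x + lp_knorm y.
Proof.
rewrite -of_realD ler_of_real -lee_fin EFinD !lp_normE.
exact: (lp_enormD p1 (x : nat -> X) y).
Qed.

Lemma lp_knormZ (a : K) x : lp_knorm (a *: x) = `|a| * lp_knorm x.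
Proof.
rewrite -(of_real_rnorm (a : K^o)) -of_realM; congr of_real.
apply: EFin_inj; rewrite EFinM !lp_normE.
exact: (lp_enormZ p1 a (x : nat -> X)).
Qed.

Lemma lp_knorm_eq0 x : lp_knorm x = 0 -> x = 0.
Proof.
rewrite -(of_real0 R k) => /(can_inj (@of_realK R k)) x0.
apply/val_inj/funext => j; apply: rnorm_eq0; apply/eqP.
rewrite eq_le rnorm_ge0 andbT -x0 -lee_fin lp_normE.
exact: (rnorm_le_lp_enorm p1).
Qed.

HB.instance Definition _ := Lmodule_isNormed.Build K (lp p1)
  lp_knormD lp_knormZ lp_knorm_eq0.

Lemma rnorm_lpE x : (rnorm x)%:E = lp_enorm p x.
Proof. by rewrite /rnorm of_realK lp_normE. Qed.
End lp_space.

Arguments lp {R k p} X p1.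

Section Psi.
Variables (R : realType) (k : scalars).
Local Notation K := (scalar_field R k).

Lemma lp_enorm_le (X Y : normedModType K) (p a : R) (x : nat -> X)
    (y : nat -> Y) : 1 <= p -> 0 <= a ->
  (forall j, rnorm (x j) <= a * rnorm (y j)) ->
  (lp_enorm p x <= a%:E * lp_enorm p y)%E.
Proof.
move=> p1 a0 xy; have p0 : 0 < p by exact: lt_le_trans p1.
have -> : a%:E = ((a `^ p)%:E `^ p^-1)%E.
  by rewrite poweR_EFin -powRrM mulfV ?gt_eqF// powRr1.
have ge0 (Z : normedModType K) (z : nat -> Z) :
    (0 <= \sum_(0 <= j <oo) (rnorm (z j) `^ p)%:E)%E.
  by apply: nneseries_ge0 => j _ _; rewrite lee_fin powR_ge0.
rewrite -poweRM ?lee_fin ?powR_ge0// -nneseriesZl; last first.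
  by move=> j _; rewrite lee_fin powR_ge0.
apply: gt0_ler_poweR; rewrite ?invr_ge0 ?(ltW p0)//.
- by rewrite in_itv /= leey andbT.
- rewrite in_itv /= leey andbT nneseries_ge0// => j _ _.
  by rewrite -EFinM lee_fin mulr_ge0 ?powR_ge0.
apply: lee_nneseries => [j _ _|j _]; rewrite -?EFinM lee_fin ?powR_ge0//.
rewrite -powRM ?rnorm_ge0//.
by apply: ge0_ler_powR; rewrite ?nnegrE ?mulr_ge0 ?rnorm_ge0 ?(ltW p0).
Qed.

Lemma lp_enorm_nincr (X : normedModType K) (r s : R) (x : nat -> X) :
  1 <= r -> r <= s -> (lp_enorm s x <= lp_enorm r x)%E.
Proof.
move=> r1 rs; have r0 : 0 < r by exact: lt_le_trans r1.
have s0 : 0 < s by exact: lt_le_trans rs.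
have [->|] := eqVneq (lp_enorm r x) +oo%E; first by rewrite leey.
rewrite -ltey => xoo.
have Hn : (fine (lp_enorm r x))%:E = lp_enorm r x.
  by rewrite fineK// ge0_fin_numE ?lp_enorm_ge0.
set n := fine _ in Hn.
have n0 : 0 <= n by rewrite -lee_fin Hn lp_enorm_ge0.
have xn j : rnorm (x j) <= n by rewrite -lee_fin Hn rnorm_le_lp_enorm.
have Hsum : (\sum_(0 <= j <oo) (rnorm (x j) `^ r)%:E = (n `^ r)%:E)%E.
  rewrite -poweR_EFin Hn /lp_enorm -poweRrM mulVf ?gt_eqF// poweRe1//.
  by apply: nneseries_ge0 => j _ _; rewrite lee_fin powR_ge0.
have split_s a : a `^ s = a `^ (s - r) * a `^ r.
  by rewrite -powRD ?subrK// gt_eqF.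
rewrite -Hn -[leRHS](_ : ((n `^ s)%:E `^ s^-1)%E = _); last first.
  by rewrite poweR_EFin -powRrM mulfV ?gt_eqF// powRr1.
apply: gt0_ler_poweR; rewrite ?invr_ge0 ?(ltW s0)//.
- rewrite in_itv /= leey andbT nneseries_ge0// => j _ _.
  by rewrite lee_fin powR_ge0.
- by rewrite in_itv /= leey andbT lee_fin powR_ge0.
rewrite split_s EFinM -Hsum -nneseriesZl; last first.
  by move=> j _; rewrite lee_fin powR_ge0.
apply: lee_nneseries => [j _ _|j _]; rewrite -?EFinM lee_fin ?powR_ge0//.
rewrite split_s ler_wpM2r ?powR_ge0//.
by apply: ge0_ler_powR; rewrite ?nnegrE ?rnorm_ge0 ?subr_ge0.
Qed.

Lemma bounded_clin (U V : normedModType K) (f : U -> V) (M : R) :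
  0 <= M -> linear f -> (forall u, rnorm (f u) <= M * rnorm u) ->
  f \in @clin_pred R k U V.
Proof.
move=> M0 lf fM; rewrite inE; split=> //.
pose f' : {linear U -> V} := HB.pack f (GRing.isLinear.Build _ _ _ _ _ lf).
apply: (@bounded_linear_continuous _ _ _ f').
apply/linear_boundedP; near=> t => u; rewrite -[`|f' u|]of_real_rnorm.
apply: (@le_trans _ _ (of_real k (M * rnorm u))).
  by rewrite ler_of_real; exact: fM.
rewrite of_realM of_real_rnorm ler_wpM2r//.
near: t; apply: nbhs_pinfty_ge; apply: ger0_real.
by rewrite -(of_real0 R k) ler_of_real.
Unshelve. all: by end_near. Qed.

Variables (X : normedModType K) (r s : R) (r1 : 1 <= r) (rs : r <= s).

Lemma Psi_enorm (phi : lp (dual X) r1) (x : X) :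
  (lp_enorm s (fun j => (phi j x : K^o)) <= (rnorm x)%:E * (rnorm phi)%:E)%E.
Proof.
apply: le_trans (lp_enorm_nincr _ r1 rs) _.
rewrite rnorm_lpE; apply: lp_enorm_le; rewrite ?rnorm_ge0// => j.
by rewrite mulrC rnorm_clinE rnorm_clin.
Qed.

Lemma Psi_val_subproof (phi : lp (dual X) r1) (x : X) :
  (fun j => phi j x : K^o) \in @lp_pred R k s K^o.
Proof. by rewrite inE /=; apply: le_lt_trans (Psi_enorm phi x) _; rewrite -EFinM ltry. Qed.

Definition Psi_val (phi : lp (dual X) r1) (x : X) :
    lp (K^o : normedModType K) (le_trans r1 rs) :=
  Lp (le_trans r1 rs) (Psi_val_subproof phi x).

Lemma Psi_subproof (phi : lp (dual X) r1) :
  Psi_val phi \in @clin_pred R k X _.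
Proof.
apply: (@bounded_clin _ _ _ (rnorm phi)); first exact: rnorm_ge0.
  by move=> a x y; apply/val_inj/funext => j /=; exact: linearP.
by move=> x; rewrite -lee_fin rnorm_lpE mulrC EFinM; exact: Psi_enorm.
Qed.

Definition Psi (phi : lp (dual X) r1) :
    clin X (lp (K^o : normedModType K) (le_trans r1 rs)) :=
  Clin (Psi_subproof phi).
End Psi.

Section summing.
Variables (R : realType) (k : scalars).
Local Notation K := (scalar_field R k).

Section weak.
Variables (U : normedModType K) (p : R).

Definition weakly_summable (u : nat -> U) : Prop :=
  forall f : dual U, (lp_enorm p (fun j => f (u j) : K^o) < +oo)%E.

Definition weak_enorm (u : nat -> U) : \bar R :=
  ereal_sup [set lp_enorm p (fun j => f (u j) : K^o) |
    f in [set f : dual U | rnorm f <= 1]].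
End weak.

Section absolutely_summing.
Variables (U Y : normedModType K) (q p : R).

Definition summing_bound (S : clin U Y) (C : R) : Prop :=
  forall u : nat -> U, weakly_summable p u ->
    (lp_enorm q (fun j => S (u j)) <= C%:E * weak_enorm p u)%E.

Definition abs_summing (S : clin U Y) : Prop :=
  exists2 C : R, 0 <= C & summing_bound S C.

(* [+oo] when S is not absolutely (q;p)-summing *)
Definition pi_norm (S : clin U Y) : \bar R :=
  ereal_inf [set C%:E | C in [set C : R | 0 <= C /\ summing_bound S C]].
End absolutely_summing.

Section anisotropic.
Variables (U X : normedModType K) (s q r : R) (r1 : 1 <= r) (p : R).

Definition aniso_sum (phi : nat -> dual X) (x : nat -> X) : \bar R :=
  (\sum_(0 <= j <oo)
     (\sum_(0 <= i <oo) (rnorm (phi i (x j) : K^o) `^ s)%:E) `^ (q / s))%E.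

Definition aniso_summable (x : nat -> X) : Prop :=
  forall phi : lp (dual X) r1, (aniso_sum phi x < +oo)%E.

Definition weakly_aniso_summing (T : clin U X) : Prop :=
  forall u : nat -> U, weakly_summable p u ->
    aniso_summable (fun j => T (u j)).

Definition weakly_aniso_bound (T : clin U X) (D : R) : Prop :=
  forall u : nat -> U, weakly_summable p u -> forall phi : lp (dual X) r1,
    (aniso_sum phi (fun j => T (u j)) `^ q^-1 <=
       D%:E * (rnorm phi)%:E * weak_enorm p u)%E.

(* [+oo] when no D satisfies the bound *)
Definition weakly_aniso_norm (T : clin U X) : \bar R :=
  ereal_inf [set D%:E | D in [set D : R | 0 < D /\ weakly_aniso_bound T D]].
End anisotropic.
End summing.

(* Main.v *)
(** Statement (i) forces a bound that is joint in the sequences [u] and [phi].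
    If none held, there would be pairs [(u n, phi n)], with norms
    decaying geometrically, whose anisotropic sums are unbounded; interleaving
    the [u n] into one sequence and the [phi n] into another gives one pair
    violating (i). Conversely, (ii) yields summability because the weak norm of
    a weakly summable sequence is finite: otherwise the lower semicontinuous
    seminorm [f |-> ||(f (u j))_j||_p] on the dual would exceed each [n] on a
    dense open set, so by Baire's theorem it would be infinite somewhere. The
    equality of norms follows by homogeneity in [phi]. *)

Require Import Defs.
From mathcomp Require Import all_boot all_order all_algebra.
From mathcomp Require Import complex ring lra.
From mathcomp Require Import all_classical all_reals all_analysis.

Set Implicit Arguments.
Unset Strict Implicit.
Unset Printing Implicit Defensive.

Import Order.TTheory GRing.Theory Num.Theory.
Import numFieldNormedType.Exports.

Local Open Scope classical_set_scope.
Local Open Scope ring_scope.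

(** * Cauchy sequences in the dual and Baire's theorem *)

Section completeness.
Variable R : realType.

(** The intervals of centre [a n] and radius [e n] meet pairwise, as [a (maxn n m)] lies in both the
    n-th and the m-th; hence the supremum of their left ends lies in all of them. *)
Lemma real_cauchy_rate (a e : nat -> R) :
  (forall n m, (n <= m)%N -> `|a m - a n| <= e n) ->
  exists l, forall n, `|l - a n| <= e n.
Proof.
move=> ae.
have aeN n m : a n - e n <= a m + e m.
  have := ae _ _ (leq_maxl n m); have := ae _ _ (leq_maxr n m).
  rewrite !ler_distlC => /andP[? ?] /andP[? ?].
  lra.
have ne : [set a n - e n | n in setT] !=set0 by exists (a 0 - e 0), 0%N.
have ub n : ubound [set a n - e n | n in setT] (a n + e n).
  by move=> _ [m _ <-].
exists (sup [set a n - e n | n in setT]) => n.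
rewrite ler_distl; apply/andP; split.
  by apply: sup_upper_bound; [split=> //; exists (a n + e n)|exists n].
exact: ge_sup.
Qed.

Variable k : scalars.
Local Notation K := (scalar_field R k).

Lemma rnormN (V : normedModType K) (x : V) : rnorm (- x) = rnorm x.
Proof. by rewrite /rnorm normrN. Qed.

(* The factor [2] comes from the complex case, where the errors on the real and
   imaginary parts add up. *)
Lemma scalar_cauchy_rate (a : nat -> K^o) (e : nat -> R) :
  (forall n m, (n <= m)%N -> rnorm (a m - a n) <= e n) ->
  exists l : K^o, forall n, rnorm (l - a n) <= 2 * e n.
Proof.
move=> ae; have e_ge0 n : 0 <= e n.
  by have := ae n n (leqnn n); rewrite subrr rnorm0.
case: k a ae => /= a ae.
  have [l le] := real_cauchy_rate ae.
  by exists l => n; rewrite (le_trans (le n))// ler_peMl// ler1n.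
have RM (z : R[i]) : `|complex.Re z| <= complex.Re `|z|.
  by case: z => x y; rewrite normc_def /= -sqrtr_sqr ler_wsqrtr// lerDl sqr_ge0.
have IM (z : R[i]) : `|complex.Im z| <= complex.Re `|z|.
  by case: z => x y; rewrite normc_def /= -sqrtr_sqr ler_wsqrtr// lerDr sqr_ge0.
have MRI (z : R[i]) :
    complex.Re `|z| <= `|complex.Re z| + `|complex.Im z|.
  case: z => x y; rewrite normc_def /= -[leRHS]ger0_norm ?addr_ge0//.
  rewrite -sqrtr_sqr ler_wsqrtr// sqrrD !real_normK ?num_real// -addrA.
  by rewrite lerD2l lerDr mulrn_wge0// mulr_ge0.
have reB (x y : R[i]) : complex.Re (x - y) = complex.Re x - complex.Re y.
  by case: x y => [? ?] [? ?].
have imB (x y : R[i]) : complex.Im (x - y) = complex.Im x - complex.Im y.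
  by case: x y => [? ?] [? ?].
have [x xe] : exists x, forall n, `|x - complex.Re (a n)| <= e n.
  apply: (@real_cauchy_rate (fun n => complex.Re (a n))) => n m nm.
  by rewrite -reB (le_trans (RM _))// ae.
have [y ye] : exists y, forall n, `|y - complex.Im (a n)| <= e n.
  apply: (@real_cauchy_rate (fun n => complex.Im (a n))) => n m nm.
  by rewrite -imB (le_trans (IM _))// ae.
exists (x +i* y)%C => n; apply: (le_trans (MRI _)).
by rewrite reB imB /= mulr_natl mulr2n lerD.
Qed.

(** Lets an identity pass to a limit from error bounds alone, when applied to the difference of its
    two sides. *)
Lemma rnorm_small (V : normedModType K) (x : V) (C : R) (e : nat -> R) :
  0 <= C -> (forall d, 0 < d -> exists n, e n < d) ->
  (forall n, rnorm x <= C * e n) -> x = 0.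
Proof.
move=> C0 e0 xC; apply: rnorm_eq0; apply/eqP; rewrite eq_le rnorm_ge0 andbT.
apply/ler_addgt0Pr => d d0; rewrite add0r.
have C1 : 0 < C + 1 by rewrite ltr_wpDl.
have [n en] := e0 (d / (C + 1)) (divr_gt0 d0 C1).
rewrite (le_trans (xC n))// (le_trans (ler_wpM2l C0 (ltW en)))//.
by rewrite mulrCA ler_piMr ?(ltW d0)// ler_pdivrMr// mul1r lerDl.
Qed.

Variable U : normedModType K.

Lemma clin_valB (V W : normedModType K) (f g : clin V W) v :
  (f - g) v = f v - g v.
Proof. by []. Qed.

(** The limit is taken pointwise, with errors uniform on the unit ball; the smallness of [e] serves
    to make it linear. *)
Lemma dual_cauchy_rate (x : nat -> dual U) (e : nat -> R) :
  (forall d, 0 < d -> exists n, e n < d) ->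
  (forall n m, (n <= m)%N -> rnorm (x m - x n) <= e n) ->
  exists f : dual U, forall n, rnorm (f - x n) <= 2 * e n.
Proof.
move=> e0 xe.
have e_ge0 n : 0 <= e n by have := xe n n (leqnn n); rewrite subrr rnorm0.
have /choice[f fx] : forall u, exists l : K^o,
    forall n, rnorm (l - x n u) <= 2 * (e n * rnorm u).
  move=> u; apply: scalar_cauchy_rate => n m nm.
  by rewrite -clin_valB (le_trans (rnorm_clin _ _))// ler_wpM2r ?rnorm_ge0//
    -rnorm_clinE xe.
have flin : linear (f : U -> K^o).
  (* The defect of linearity is a combination of errors against the linear map [x n], so it is at
     most a constant times every [e n]. *)
  move=> a u v; apply/eqP; rewrite -subr_eq0; apply/eqP.
  apply: (@rnorm_small _ _ (2 * rnorm (a *: u + v) +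
    (rnorm (a : K^o) * (2 * rnorm u) + 2 * rnorm v)) e) => // [|n].
    by rewrite !addr_ge0// !mulr_ge0 ?rnorm_ge0// mulr_ge0// rnorm_ge0.
  have -> : f (a *: u + v) - (a *: f u + f v) =
      (f (a *: u + v) - x n (a *: u + v)) -
      (a *: (f u - x n u) + (f v - x n v)).
    rewrite [in RHS](clin_linear (x n) a u v) [in RHS]scalerBr.
    by rewrite [X in _ = _ - X]addrACA -opprD [X in _ = _ + X]opprB subrKA.
  rewrite (le_trans (rnormD _ _))// rnormN [leRHS]mulrDl lerD//.
    by rewrite -mulrA (mulrC _ (e n)) fx.
  rewrite (le_trans (rnormD _ _))// [leRHS]mulrDl lerD//; last first.
    by rewrite -mulrA (mulrC _ (e n)) fx.
  by rewrite rnormZ -mulrA ler_wpM2l ?rnorm_ge0// -mulrA (mulrC _ (e n)) fx.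
have fB u : rnorm (f u) <= (2 * e 0 + opnorm (x 0)) * rnorm u.
  rewrite -[f u](subrK (x 0 u)) (le_trans (rnormD _ _))// [leRHS]mulrDl lerD//.
    by rewrite -mulrA fx.
  exact: rnorm_clin.
have fM : (f : U -> K^o) \in @clin_pred R k U K^o.
  apply: (bounded_clin _ flin fB).
  by rewrite addr_ge0// ?opnorm_ge0// mulr_ge0.
exists (Clin fM) => n; rewrite rnorm_clinE; apply: opnorm_le => u u1.
rewrite clin_valB (le_trans (fx u n))// ler_wpM2l// ler_piMr//.
Qed.

(** Baire's theorem by nested balls: the hypothesis makes the interior of each [P n] dense, and the
    centres of the chosen balls converge to a point in all of them. *)
Lemma dual_baire (P : nat -> dual U -> Prop) :
  (forall n f (r : R), 0 < r -> exists g (r' : R), [/\ 0 < r',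
     rnorm (g - f) <= r & forall h, rnorm (h - g) <= r' -> P n h]) ->
  exists f, forall n, P n f.
Proof.
move=> HP.
(* The factor [2] on the shift of the centre makes up for the factor [2] lost in [dual_cauchy_rate];
   radii at most [n.+1%:R^-1] become arbitrarily small. *)
have step (nfr : nat * (dual U * R)) : exists gr : dual U * R,
    0 < nfr.2.2 -> [/\ 0 < gr.2, gr.2 <= nfr.1.+1%:R^-1,
     2 * rnorm (gr.1 - nfr.2.1) + gr.2 <= nfr.2.2 &
     forall h, rnorm (h - gr.1) <= gr.2 -> P nfr.1 h].
  case: nfr => n [f r] /=; have [r0|r0] := ltP 0 r; last by exists (0, 0).
  have r40 : 0 < r / 4 by rewrite divr_gt0.
  have [g [r' [r'0 gf gP]]] := HP n f _ r40.
  exists (g, Num.min r' (Num.min (r / 2) n.+1%:R^-1)) => _ /=; split.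
  - by rewrite !lt_min r'0 invr_gt0 ltr0Sn divr_gt0.
  - by rewrite !ge_min lexx !orbT.
  - rewrite (le_trans (lerD (ler_wpM2l _ gf) (_ : _ <= r / 2)))//.
      by rewrite !ge_min lexx !orbT.
    have -> : 2 * (r / 4) + r / 2 = r by field.
    by [].
  - by move=> h hg; apply: gP; rewrite (le_trans hg)// ge_min lexx.
have {step}[F HF] := choice step.
pose B := fix B n := if n is n'.+1 then F (n', B n') else (0 : dual U, 1 : R).
have B0 n : 0 < (B n).2.
  by elim: n => [|n IH] /=; [exact: ltr01|have [] := HF (n, B n) IH].
have BB n m : (n <= m)%N -> 2 * rnorm ((B m).1 - (B n).1) + (B m).2 <= (B n).2.
  elim: m => [|m IH].
    by rewrite leqn0 => /eqP ->; rewrite subrr rnorm0 mulr0 add0r.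
  rewrite leq_eqVlt => /predU1P[<-|]; first by rewrite subrr rnorm0 mulr0 add0r.
  rewrite ltnS => /IH {}IH; have [_ _ h _] := HF (m, B m) (B0 m).
  have aux (x y z r r' r'' : R) : z <= x + y -> 2 * x + r' <= r ->
      2 * y + r'' <= r' -> 2 * z + r'' <= r by lra.
  by apply: aux IH h; rewrite [leRHS]addrC;
    apply: le_trans (rnormD _ _); rewrite subrKA.
have [f fB] : exists f : dual U,
    forall n, rnorm (f - (B n).1) <= 2 * ((B n).2 / 2).
  apply: dual_cauchy_rate => [d d0|n m nm].
    exists (Num.truncn d^-1).+1 => /=.
    have [/= _ h _ _] := HF (Num.truncn d^-1, B (Num.truncn d^-1)) (B0 _).
    rewrite ltr_pdivrMr// (le_lt_trans h)// (@lt_trans _ _ d)//; last first.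
      by rewrite ltr_pMr// ltr1n.
    rewrite -[ltRHS]invrK ltf_pV2 ?posrE ?invr_gt0 ?ltr0Sn//.
    exact: truncnS_gt.
  rewrite ler_pdivlMr// mulrC (le_trans _ (BB _ _ nm))// lerDl.
  exact: ltW.
(* [P n] is secured by the ball of index [n.+1], which contains the limit [f]. *)
exists f => n; have [_ _ _ h] := HF (n, B n) (B0 n).
by apply: h; rewrite (le_trans (fB n.+1))//= mulrC divfK.
Qed.

End completeness.

Lemma ge0_lty_nat (R : realType) (x : \bar R) : (0 <= x -> x < +oo ->
  exists n : nat, x <= n%:R%:E)%E.
Proof.
move=> x0 xoo; exists (Num.truncn (fine x)).+1.
by rewrite -[leLHS]fineK ?ge0_fin_numE// lee_fin ltW// truncnS_gt.
Qed.

(** * Powers and truncations of sequence norms *)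

Section sequence_norms.
Variables (R : realType) (k : scalars).
Local Notation K := (scalar_field R k).
Variables (p : R) (p1 : 1 <= p).

Let p0 : 0 < p. Proof. exact: lt_le_trans p1. Qed.

Lemma lp_enormX (V : normedModType K) (x : nat -> V) :
  (lp_enorm p x `^ p = \sum_(0 <= j <oo) (rnorm (x j) `^ p)%:E)%E.
Proof.
rewrite /lp_enorm -poweRrM mulVf ?gt_eqF// poweRe1//.
by apply: nneseries_ge0 => j _ _; rewrite lee_fin powR_ge0.
Qed.

Lemma lee_poweR (a b : \bar R) :
  (0 <= a -> 0 <= b -> (a `^ p <= b `^ p) = (a <= b))%E.
Proof.
move=> a0 b0; apply/idP/idP => ab; last first.
  by apply: gt0_ler_poweR; rewrite ?(ltW p0)// in_itv /= leey andbT.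
have ip (c : \bar R) : (0 <= c -> c = (c `^ p) `^ p^-1)%E.
  by move=> c0; rewrite -poweRrM mulfV ?gt_eqF// poweRe1.
rewrite (ip a)// (ip b)//.
by apply: gt0_ler_poweR; rewrite ?invr_ge0 ?(ltW p0)// in_itv /= leey andbT
  poweR_ge0.
Qed.

Definition truncation (V : normedModType K) N (x : nat -> V) (j : nat) : V :=
  if (j < N)%N then x j else 0.

Lemma lp_enorm_truncation (V : normedModType K) N (x : nat -> V) :
  (lp_enorm p (truncation N x) `^ p = \sum_(0 <= j < N) (rnorm (x j) `^ p)%:E)%E.
Proof.
rewrite lp_enormX (nneseries_split 0 N)//=; last first.
  by move=> j _; rewrite lee_fin powR_ge0.
rewrite eseries0 ?adde0 => [|j Nj _].
  rewrite add0n !big_mkord; apply: eq_bigr => j _.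
  by rewrite /truncation ltn_ord.
by rewrite /truncation ltnNge Nj/= rnorm0 powR0 ?gt_eqF.
Qed.

Lemma lp_enorm_truncation_fin (V : normedModType K) N (x : nat -> V) :
  lp_enorm p (truncation N x) \is a fin_num.
Proof.
rewrite ge0_fin_numE ?lp_enorm_ge0// ltNge leye_eq; apply/negP => /eqP xoo.
have := lp_enorm_truncation N x.
by rewrite xoo poweRyr ?gt_eqF// sumEFin.
Qed.

Lemma lp_enorm_truncation_le (V : normedModType K) N (x : nat -> V) :
  (lp_enorm p (truncation N x) <= lp_enorm p x)%E.
Proof.
rewrite -[leRHS]mul1e; apply: lp_enorm_le => // j; rewrite mul1r /truncation.
by case: ifP => // _; rewrite rnorm0 rnorm_ge0.
Qed.

(** The [p]-th powers of the truncated norms are the partial sums of the series, so a common bound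
    [c] would pass to the limit. *)
Lemma lp_enorm_gt_truncation (V : normedModType K) (x : nat -> V) (c : R) :
  (c%:E < lp_enorm p x)%E ->
  exists N, (c%:E < lp_enorm p (truncation N x))%E.
Proof.
move=> cx; apply: contrapT => /forallNP cN.
have {}cN N : (lp_enorm p (truncation N x) <= c%:E)%E.
  by rewrite leNgt; apply/negP; exact: cN.
have c0 : (0 <= c%:E)%E by apply: le_trans (cN 0%N); exact: lp_enorm_ge0.
move: cx; apply/negP; rewrite -leNgt -lee_poweR ?lp_enorm_ge0// lp_enormX.
apply: lime_le.
  by apply: is_cvg_nneseries => j _ _; rewrite lee_fin powR_ge0.
by near=> N; rewrite -lp_enorm_truncation lee_poweR ?lp_enorm_ge0.
Unshelve. all: by end_near. Qed.

End sequence_norms.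

(** * Finiteness of the weak norm *)

Section weakly_summable.
Variables (R : realType) (k : scalars).
Local Notation K := (scalar_field R k).
Variables (p : R) (p1 : 1 <= p).
Variable U : normedModType K.
Implicit Types (f g h : dual U) (u : nat -> U).

(** A finite truncation already exceeds [c], and on it the seminorm is Lipschitz in the functional,
    with constant the strong norm of the truncated [u]. *)
Lemma lp_enorm_dual_lsc u g (c : R) :
  (c%:E < lp_enorm p (fun j => g (u j) : K^o))%E ->
  exists2 r : R, 0 < r & forall h, rnorm (h - g) <= r ->
    (c%:E < lp_enorm p (fun j => h (u j) : K^o))%E.
Proof.
move=> /(lp_enorm_gt_truncation p1)[N].
set x := fun j => g (u j); set Q := lp_enorm p _ => cQ.
set B := lp_enorm p (truncation N u).
have /EFin_fin_numP[q Qq] : Q \is a fin_num by exact: lp_enorm_truncation_fin.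
have /EFin_fin_numP[b Bb] : B \is a fin_num by exact: lp_enorm_truncation_fin.
have b0 : 0 <= b by rewrite -lee_fin -Bb lp_enorm_ge0.
have b1 : 0 < b + 1 by rewrite ltr_wpDl.
have cq : c < q by rewrite -lte_fin -Qq.
(* Half of the gap [q - c] is spent on the perturbation; [b + 1] keeps the divisor positive when [b]
   is zero. *)
exists ((q - c) / 2 / (b + 1)) => [|h hr].
  by rewrite !divr_gt0// subr_gt0.
set y := fun j => h (u j) : K^o.
have : (Q <= lp_enorm p y + (rnorm (h - g))%:E * B)%E.
  apply: le_trans (leeD (lp_enorm_truncation_le p1 N y) (lexx _)).
  pose z j : K^o := truncation N (fun j => (g - h) (u j) : K^o) j.
  rewrite /Q (_ : truncation N x = fun j => truncation N y j + z j); last first.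
    apply/funext => j; rewrite /z /truncation; case: ifP => _; rewrite ?addr0//.
    by rewrite clin_valB addrC subrK.
  apply: (le_trans (lp_enormD p1 _ _)); rewrite leeD2l//.
  apply: lp_enorm_le; rewrite ?rnorm_ge0// => j; rewrite /z /truncation.
  case: ifP => _; last by rewrite !rnorm0 mulr0.
  by rewrite -(rnormN (h - g)) opprB rnorm_clinE rnorm_clin.
rewrite Qq Bb -EFinM => qy.
rewrite -(@lteD2rE _ ((rnorm (h - g) * b)%:E))//.
apply: lt_le_trans qy.
rewrite -EFinD lte_fin; move: (rnorm (h - g)) (rnorm_ge0 (h - g)) hr => d d0 hr.
rewrite (@le_lt_trans _ _ (c + (q - c) / 2))//; last by clear -cq; lra.
rewrite lerD2l (@le_trans _ _ (d * (b + 1)))//.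
  by rewrite ler_wpM2l// lerDl.
by rewrite -ler_pdivlMr.
Qed.

Lemma weak_enorm_ge0 u : (0 <= weak_enorm p u)%E.
Proof.
apply: le_trans (lp_enorm_ge0 p (fun j => (0 : dual U) (u j) : K^o)) _.
by apply: ereal_sup_ubound; exists 0 => //=; rewrite rnorm0.
Qed.

Lemma weak_enorm_lty u : weakly_summable p u -> (weak_enorm p u < +oo)%E.
Proof.
move=> uw; rewrite ltNge leye_eq; apply/negP => /eqP woo.
have [f fP] : exists f : dual U, forall n : nat,
    (n%:R%:E < lp_enorm p (fun j => f (u j) : K^o))%E.
  apply: dual_baire => n f r r0.
  set Qf := lp_enorm p (fun j => f (u j) : K^o).
  have Qfin : Qf \is a fin_num by rewrite ge0_fin_numE ?lp_enorm_ge0 ?uw.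
  (* A functional [d] of the unit ball with a seminorm this large, scaled by [r] and added to [f],
     has by the triangle inequality a seminorm above [n], and the sum stays within [r] of [f]. *)
  have : (((n%:R + fine Qf) / r)%:E < weak_enorm p u)%E by rewrite woo ltry.
  move=> /ereal_sup_gt[_ [d /= d1 <-] nd].
  have nr : rnorm (of_real k r : K^o) = r by rewrite rnorm_of_real// ltW.
  pose g : dual U := f + of_real k r *: d.
  have /lp_enorm_dual_lsc[r' r'0 gr'] :
      (n%:R%:E < lp_enorm p (fun j => g (u j) : K^o))%E.
    rewrite -(@lteD2rE _ Qf)// -[X in (_ + X)%E](fineK Qfin) -EFinD.
    move: nd; rewrite EFinM lte_pdivrMr// muleC -{1}nr.
    rewrite -(lp_enormZ p1) => /lt_le_trans; apply.
    have -> : (fun j => of_real k r *: (d (u j) : K^o)) =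
        (fun j => (g (u j) : K^o) + (- 1 : K) *: (f (u j) : K^o)).
      by apply/funext => j; rewrite scaleN1r /g /= addrC addKr.
    apply: (le_trans (lp_enormD p1 _ _)); rewrite leeD2l// lp_enormZ//.
    by rewrite rnormN /rnorm normr1 -(of_real1 R k) of_realK mul1e.
  exists g, r'; split=> //.
  by rewrite /g addrC addKr rnormZ nr ler_piMr// ltW.
have [n /(lt_le_trans (fP n))] := ge0_lty_nat (lp_enorm_ge0 p _) (uw f).
by rewrite ltxx.
Qed.

(** Normalising by [rnorm f + 1] allows [f = 0]; the loss in the constant does not affect the
    finiteness of an interleaved sum. *)
Lemma lp_enorm_dual_le u f (c : R) : (weak_enorm p u <= c%:E)%E ->
  (lp_enorm p (fun j => f (u j) : K^o) <= ((rnorm f + 1) * c)%:E)%E.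
Proof.
move=> uc; have f0 := rnorm_ge0 f; set t := rnorm f + 1.
have t0 : 0 < t by rewrite ltr_wpDl.
have nt : rnorm (of_real k t^-1 : K^o) = t^-1.
  by rewrite rnorm_of_real// invr_ge0 ltW.
have : (lp_enorm p (fun j => (of_real k t^-1 *: f) (u j) : K^o) <= c%:E)%E.
  apply: le_trans uc; apply: ereal_sup_ubound; exists (of_real k t^-1 *: f) => //=.
  by rewrite rnormZ nt ler_pdivrMl// mulr1 lerDl.
by rewrite (lp_enormZ p1 _ (fun j => f (u j) : K^o)) nt lee_pdivrMl// EFinM.
Qed.

Lemma weak_enormZ u (a : K) :
  (weak_enorm p (fun j => a *: u j) <= (rnorm (a : K^o))%:E * weak_enorm p u)%E.
Proof.
apply: ge_ereal_sup => _ [f /= f1 <-].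
have -> : (fun j => f (a *: u j) : K^o) = (fun j => a *: (f (u j) : K^o)).
  by apply/funext => j; rewrite linearZ.
rewrite lp_enormZ// lee_wpmul2l ?lee_fin ?rnorm_ge0//.
by apply: ereal_sup_ubound; exists f.
Qed.

Lemma weakly_summableZ u (a : K) :
  weakly_summable p u -> weakly_summable p (fun j => a *: u j).
Proof.
move=> uw f.
have -> : (fun j => f (a *: u j) : K^o) = (fun j => a *: (f (u j) : K^o)).
  by apply/funext => j; rewrite linearZ.
by rewrite lp_enormZ// lte_mul_pinfty ?lee_fin ?rnorm_ge0// uw.
Qed.

End weakly_summable.

(** * Interleaving of sequences *)

Section interleaving.
Variables (R : realType) (k : scalars).
Local Notation K := (scalar_field R k).
Variables (p : R) (p1 : 1 <= p).
Variable V : normedModType K.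

Let p0 : 0 < p. Proof. exact: lt_le_trans p1. Qed.

Definition dyadic n : R := (2 ^ n.+1)%:R^-1.

Lemma dyadic_gt0 n : 0 < dyadic n.
Proof. by rewrite invr_gt0 ltr0n expn_gt0. Qed.

Lemma dyadic_le1 n : dyadic n <= 1.
Proof. by rewrite invf_le1 ?ler1n ?ltr0n expn_gt0. Qed.

(** A sum of nonnegative terms is unordered, so an injective [g] selects a subsum. This extracts one
    block from an interleaved sequence. *)
Lemma lp_enorm_subseq (x : nat -> V) (g : nat -> nat) : injective g ->
  (lp_enorm p (x \o g) <= lp_enorm p x)%E.
Proof.
move=> ginj; have pos (j : nat) : (0 <= (rnorm (x j) `^ p)%:E)%E.
  by rewrite lee_fin powR_ge0.
rewrite -(lee_poweR p1) ?lp_enorm_ge0// !lp_enormX//.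
rewrite nneseries_esumT; last by move=> j; exact: pos.
rewrite nneseries_esumT//.
rewrite -(esum_image setT g (fun j => (rnorm (x j) `^ p)%:E)); last first.
  by move=> a b _ _; exact: ginj.
by rewrite esum_mkcond; apply: le_esum => j _; case: ifP.
Qed.

(** The unordered sum is reindexed along [e], then split by Tonelli's theorem. *)
Lemma lp_enorm_interleave (x : nat -> nat -> V) (e : nat -> nat * nat) :
  bijective e ->
  (lp_enorm p (fun j => x (e j).1 (e j).2) `^ p =
   \sum_(0 <= n <oo) lp_enorm p (x n) `^ p)%E.
Proof.
move=> ebij; have pos (n j : nat) : (0 <= (rnorm (x n j) `^ p)%:E)%E.
  by rewrite lee_fin powR_ge0.
rewrite lp_enormX// nneseries_esumT//.
rewrite -(@reindex_esum _ _ _ setT setT e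
  (fun nj => (rnorm (x nj.1 nj.2) `^ p)%:E)) ?setTT_bijective//.
rewrite nneseries_esumT; last by move=> n; exact: poweR_ge0.
rewrite (_ : setT = setT `*`` (fun=> setT)); last first.
  by apply/seteqP; split.
rewrite -(@esum_esum _ _ _ _ _ (fun n j => (rnorm (x n j) `^ p)%:E))//.
by apply: eq_esum => n _; rewrite lp_enormX// nneseries_esumT.
Qed.

Lemma lp_enorm_interleave_lty (x : nat -> nat -> V) (e : nat -> nat * nat)
    (c : R) : bijective e -> 0 <= c ->
  (forall n, lp_enorm p (x n) <= (c * dyadic n)%:E)%E ->
  (lp_enorm p (fun j => x (e j).1 (e j).2) < +oo)%E.
Proof.
move=> ebij c0 xc; apply: (@lty_poweRy _ _ p); first by rewrite gt_eqF.
rewrite lp_enorm_interleave//.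
have d0 n := dyadic_gt0 n.
apply: (@le_lt_trans _ _ (\sum_(0 <= n <oo) (c `^ p / (2 ^ (n + 1))%:R)%:E)%E).
  apply: lee_nneseries => [n _ _|n _]; first exact: poweR_ge0.
  rewrite (@le_trans _ _ ((c * dyadic n)%:E `^ p)%E)//.
    by rewrite lee_poweR ?lp_enorm_ge0// lee_fin mulr_ge0// ltW.
  rewrite poweR_EFin lee_fin powRM// ?(ltW (d0 n))// ler_wpM2l ?powR_ge0//.
  (* As [dyadic n] is in (0, 1] and [1 <= p], its [p]-th power is at most itself, which leaves a
     geometric series. *)
  rewrite addn1 -[leRHS]powRr1 ?(ltW (d0 n))//.
  by rewrite ger_powR// d0 dyadic_le1.
rewrite (cvg_lim _ (cvg_geometric_eseries_half (n := 0)))//.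
exact: ltry.
Qed.

End interleaving.

Lemma nat_pairing : exists e : nat -> nat * nat, bijective e.
Proof.
have /card_set_bijP[e] := card_nat2.
by rewrite setTT_bijective => -[i ei ie]; exists i, e.
Qed.

(** Allows dividing by numbers [b] strictly above a norm [a], positive even when the norm vanishes,
    and returning to [a] afterwards. *)
Lemma lee_mul_limr (R : realType) (x : \bar R) (C a : R) : 0 <= C ->
  (forall b, a < b -> (x <= (C * b)%:E)%E) -> (x <= (C * a)%:E)%E.
Proof.
move=> C0 xC; apply/lee_addgt0Pr => d d0; have C1 : 0 < C + 1 by rewrite ltr_wpDl.
apply: (le_trans (xC (a + d / (C + 1)) _)).
  by rewrite ltrDl divr_gt0.
rewrite -EFinD lee_fin mulrDr lerD2l mulrCA ler_piMr ?(ltW d0)//.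
by rewrite ler_pdivrMr// mul1r lerDl.
Qed.

Lemma lp_valZ (R : realType) (k : scalars)
    (V : normedModType (scalar_field R k)) (p : R) (p1 : 1 <= p)
    (a : scalar_field R k) (x : lp V p1) j : (a *: x) j = a *: x j.
Proof. by []. Qed.

Lemma clin_valZ (R : realType) (k : scalars)
    (V W : normedModType (scalar_field R k)) (a : scalar_field R k)
    (f : clin V W) v : (a *: f) v = a *: f v.
Proof. by []. Qed.

(** * Uniform bounds for anisotropic summing operators *)

Section anisotropic.
Variables (R : realType) (k : scalars).
Local Notation K := (scalar_field R k).
Variables (p q r s : R) (p1 : 1 <= p) (q1 : 1 <= q) (r1 : 1 <= r) (rs : r <= s).
Variables (U X : normedModType K).
Implicit Types (phi : lp (dual X) r1) (T : clin U X).

Let q0 : 0 < q. Proof. exact: lt_le_trans q1. Qed.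
Let s1 : 1 <= s. Proof. exact: le_trans rs. Qed.

(** Each inner sum raised to [q / s] is the [q]-th power of the norm of [Psi rs phi (x j)], so the
    anisotropic sum becomes a strong [q]-norm. *)
Lemma aniso_sumE phi (x : nat -> X) :
  (aniso_sum s q phi x `^ q^-1 = lp_enorm q (fun j => Psi rs phi (x j)))%E.
Proof.
rewrite /lp_enorm /aniso_sum; congr poweR; apply: eq_eseriesr => j _.
rewrite -poweR_EFin rnorm_lpE /lp_enorm -poweRrM; congr poweR.
by rewrite mulrC.
Qed.

Lemma aniso_sum_lty phi (x : nat -> X) :
  (aniso_sum s q phi x < +oo)%E <->
  (lp_enorm q (fun j => Psi rs phi (x j)) < +oo)%E.
Proof.
rewrite -aniso_sumE; split; first exact: poweR_lty.
by apply: lty_poweRy; rewrite invr_neq0// gt_eqF.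
Qed.

Lemma Psi_enormZl phi (x : nat -> X) (a : K) :
  (lp_enorm q (fun j => Psi rs (a *: phi) (x j)) =
   (rnorm (a : K^o))%:E * lp_enorm q (fun j => Psi rs phi (x j)))%E.
Proof.
rewrite -(lp_enormZ q1); congr lp_enorm; apply/funext => j.
apply: val_inj; apply/funext => l.
by rewrite [RHS]lp_valZ -clin_valZ -lp_valZ.
Qed.

Lemma Psi_enormZr T phi (u : nat -> U) (a : K) :
  (lp_enorm q (fun j => Psi rs phi (T (a *: u j))) =
   (rnorm (a : K^o))%:E * lp_enorm q (fun j => Psi rs phi (T (u j))))%E.
Proof.
rewrite -(lp_enormZ q1); congr lp_enorm; apply/funext => j.
by rewrite !linearZ.
Qed.

(* A counterexample for each [n] would be a pair [(u n, phi n)]; interleaving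
   the sequences [u n], and the sequences [phi n], along one bijection of [nat]
   with [nat * nat] gives a single pair at which the sum diverges. *)
Lemma weakly_aniso_locally_bounded T : weakly_aniso_summing s q r1 p T ->
  exists n : nat, forall (u : nat -> U) phi, weakly_summable p u ->
    (weak_enorm p u <= (dyadic R n)%:E)%E -> rnorm phi <= dyadic R n ->
    (lp_enorm q (fun j => Psi rs phi (T (u j))) <= n%:R%:E)%E.
Proof.
move=> Tw; apply: contrapT => /forallNP noT.
have {noT} /choice[F HF] : forall n : nat, exists uphi : (nat -> U) * lp (dual X) r1,
    [/\ weakly_summable p uphi.1, (weak_enorm p uphi.1 <= (dyadic R n)%:E)%E,
        rnorm uphi.2 <= dyadic R n &
        (n%:R%:E < lp_enorm q (fun j => Psi rs uphi.2 (T (uphi.1 j))))%E].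
  move=> n; apply: contrapT => nF; apply: (noT n) => u phi uw un phin.
  by rewrite leNgt; apply/negP => nlt; apply: nF; exists (u, phi).
have [e ebij] := nat_pairing.
have [i ei ie] := ebij.
pose v j := (F (e j).1).1 (e j).2.
pose psi0 j := (F (e j).1).2 (e j).2.
have vw : weakly_summable p v.
  move=> f; apply: (@lp_enorm_interleave_lty _ _ _ p1 K^o
    (fun n j => f ((F n).1 j) : K^o) e (rnorm f + 1) ebij).
    by rewrite addr_ge0// rnorm_ge0.
  by move=> n; apply: lp_enorm_dual_le => //; have [] := HF n.
have psiP : psi0 \in @lp_pred R k r (dual X).
  rewrite inE /=; apply: (@lp_enorm_interleave_lty _ _ _ r1 (dual X)
    (fun n j => (F n).2 j) e 1 ebij) => // n.
  by rewrite mul1r -rnorm_lpE lee_fin; have [] := HF n.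
pose psi : lp (dual X) r1 := Lp r1 psiP.
(* The number [n] bounding the norm at [(v, psi)] is also the index of the block that violates this
   bound. *)
have /ge0_lty_nat[|n] := (aniso_sum_lty psi (fun j => T (v j))).1 (Tw v vw psi).
  exact: lp_enorm_ge0.
apply/negP; rewrite -ltNge; have [_ _ _ /lt_le_trans] := HF n; apply.
(* The indices [i (n, j)] pick block [n]; restricting to them the outer [q]-norm, then the inner
   [s]-norm, leaves the norm at the pair [F n]. *)
have iinj : injective (fun j => i (n, j)).
  by move=> a b /(can_inj ie)[].
apply: le_trans (lp_enorm_subseq q1 (fun j => Psi rs psi (T (v j))) iinj).
rewrite -[leRHS]mul1e; apply: lp_enorm_le => // j; rewrite mul1r /=.
rewrite /v ie /= -lee_fin !rnorm_lpE.
apply: le_trans (@lp_enorm_subseq _ _ _ s1 K^o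
  (fun l => psi0 l (T ((F n).1 j))) _ iinj).
rewrite le_eqVlt; apply/orP; left; apply/eqP; congr lp_enorm; apply/funext => l.
by rewrite /psi0 /= ie.
Qed.

(** The local bound extends to all pairs by homogeneity in each argument. *)
Lemma weakly_aniso_summing_bound T : weakly_aniso_summing s q r1 p T ->
  exists2 D : R, 0 < D & weakly_aniso_bound s q r1 p T D.
Proof.
move=> /weakly_aniso_locally_bounded[n nT]; set h := dyadic R n in nT.
have h0 : 0 < h := dyadic_gt0 R n.
have nK (a : R) : 0 < a -> rnorm (of_real k (h / a) : K^o) = h / a.
  by move=> a0; rewrite rnorm_of_real// divr_ge0// ltW.
(* Each of the two rescalings to norm at most [h] costs a factor [h^-1]; [n.+1] instead of [n] makes
   the constant positive. *)
have D0 : 0 < n.+1%:R / h / h by rewrite !divr_gt0.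
exists (n.+1%:R / h / h) => // u uw phi; rewrite aniso_sumE.
have wfin : weak_enorm p u \is a fin_num.
  by rewrite ge0_fin_numE ?weak_enorm_ge0// weak_enorm_lty.
have w0 := weak_enorm_ge0 p u; have phi0 := rnorm_ge0 phi.
rewrite -(fineK wfin) -!EFinM; rewrite -(fineK wfin) lee_fin in w0.
have {wfin}ww : (weak_enorm p u <= (fine (weak_enorm p u))%:E)%E by rewrite fineK.
move: (fine _) w0 ww => w w0 ww.
apply: lee_mul_limr => [|b wb]; first by rewrite mulr_ge0// ltW.
have b0 : 0 < b by exact: le_lt_trans wb.
rewrite mulrAC; apply: lee_mul_limr => [|a phia].
  by rewrite mulr_ge0 ?ltW.
have a0 : 0 < a by exact: le_lt_trans phia.
have := nT _ (of_real k (h / a) *: phi) (weakly_summableZ p1 (of_real k (h / b)) uw).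
rewrite Psi_enormZl Psi_enormZr !nK// muleA -EFinM rnormZ nK//.
rewrite -lee_pdivlMl ?mulr_gt0 ?divr_gt0 ?invr_gt0// -EFinM.
have le1 : (weak_enorm p (fun j => of_real k (h / b) *: u j) <= h%:E)%E.
  apply: (le_trans (weak_enormZ p1 _ _)); rewrite nK//.
  rewrite (le_trans (lee_wpmul2l _ ww))//.
    by rewrite lee_fin divr_ge0// ltW.
  by rewrite -EFinM lee_fin mulrAC ler_pdivrMr// ler_pM2l// ltW.
have le2 : h / a * rnorm phi <= h.
  by rewrite mulrAC ler_pdivrMr// ler_pM2l// ltW.
move=> /(_ le1 le2)/le_trans; apply; rewrite lee_fin.
have -> : (h / a * (h / b))^-1 * n%:R = a / h * (b / h) * n%:R.
  by field; rewrite !gt_eqF.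
have -> : n.+1%:R / h / h * b * a = a / h * (b / h) * n.+1%:R.
  by field; rewrite !gt_eqF.
by rewrite ler_wpM2l ?ler_nat// ltW// !mulr_gt0 ?invr_gt0.
Qed.

Lemma weakly_aniso_bound_summing T (D : R) phi : 0 <= D ->
  weakly_aniso_bound s q r1 p T D -> rnorm phi <= 1 ->
  summing_bound q p (clin_comp (Psi rs phi) T) D.
Proof.
move=> D0 TD phi1 u uw; have := TD u uw phi; rewrite aniso_sumE => /le_trans.
apply; rewrite lee_wpmul2r ?weak_enorm_ge0// -EFinM lee_fin.
by rewrite ler_piMr.
Qed.

End anisotropic.

(** * The equivalence and the equality of norms *)

Theorem theorem3p9 (R : realType) (k : scalars) (p q r s : R)
    (p_ge1 : 1 <= p) (le_pq : p <= q) (lt_qs : q < s)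
    (r_ge1 : 1 <= r) (le_rs : r <= s)
    (U X : completeNormedModType (scalar_field R k)) (T : clin U X) :
  (weakly_aniso_summing s q r_ge1 p T <->
   forall phi : lp (dual X) r_ge1, rnorm phi <= 1 ->
     abs_summing q p (clin_comp (Psi le_rs phi) T)) /\
  (weakly_aniso_summing s q r_ge1 p T ->
   weakly_aniso_norm s q r_ge1 p T \is a fin_num /\
   weakly_aniso_norm s q r_ge1 p T =
     ereal_sup [set pi_norm q p (clin_comp (Psi le_rs phi) T) |
       phi in [set phi : lp (dual X) r_ge1 | rnorm phi <= 1]]).
Proof.
have q_ge1 : 1 <= q by exact: le_trans le_pq.
pose K := scalar_field R k.
split; first split.
- move=> /(weakly_aniso_summing_bound p_ge1 q_ge1 le_rs)[D D0 TD] phi phi1.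
  exists D; first exact: ltW.
  by apply: weakly_aniso_bound_summing => //; exact: ltW.
- move=> TPi u uw phi; apply/(aniso_sum_lty q_ge1 le_rs).
  (* Statement (ii) concerns the unit ball, so [phi] is divided by [t], which is positive even for
     [phi = 0]. *)
  set t := rnorm phi + 1; have t0 : 0 < t by rewrite ltr_wpDl// rnorm_ge0.
  have nt : rnorm (of_real k t^-1 : K^o) = t^-1.
    by rewrite rnorm_of_real// invr_ge0 ltW.
  have [|C C0 /(_ _ uw)] := TPi (of_real k t^-1 *: phi).
    by rewrite rnormZ nt ler_pdivrMl// mulr1 lerDl.
  rewrite /= (Psi_enormZl q_ge1) nt lee_pdivrMl// => /le_lt_trans; apply.
  rewrite lte_mul_pinfty ?lee_fin ?(ltW t0)//.
  by rewrite lte_mul_pinfty ?lee_fin// weak_enorm_lty.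
move=> /(weakly_aniso_summing_bound p_ge1 q_ge1 le_rs)[D D0 TD].
set W := weakly_aniso_norm _ _ _ _ _.
have W0 : (0 <= W)%E.
  by apply: le_ereal_inf_tmp => _ [C /= [C0 _] <-]; rewrite lee_fin ltW.
have Wfin : W \is a fin_num.
  rewrite ge0_fin_numE// (@le_lt_trans _ _ D%:E) ?ltry//.
  by apply: ereal_inf_lbound; exists D.
split=> //; apply/eqP; rewrite eq_le; apply/andP; split; last first.
  (* Every bound admissible for [W] is one for each [phi] in the unit ball, so the supremum is at
     most [W]. *)
  apply: ge_ereal_sup => _ [phi /= phi1 <-].
  apply: le_ereal_inf_tmp => _ [C /= [C0 TC] <-].
  apply: ereal_inf_lbound; exists C => //=.
  by split; [exact: ltW|apply: weakly_aniso_bound_summing => //; exact: ltW].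
set M := ereal_sup _.
have [->|Moo] := eqVneq M +oo%E; first by rewrite leey.
have M0 : (0 <= M)%E.
  apply: (@le_trans _ _
    (pi_norm q p (clin_comp (Psi le_rs (0 : lp (dual X) r_ge1)) T))).
    by apply: le_ereal_inf_tmp => _ [C /= [C0 _] <-]; rewrite lee_fin.
  by apply: ereal_sup_ubound; exists 0 => //=; rewrite rnorm0.
have /EFin_fin_numP[m Mm] : M \is a fin_num by rewrite ge0_fin_numE// ltey.
(* Conversely, [m + d] is admissible for every [d > 0]; the slack [d] also gives the positivity
   demanded of a bound and lets [pi_norm] stay strictly below [m + d]. *)
apply/lee_addgt0Pr => d d0; apply: ereal_inf_lbound.
have m0 : 0 <= m by rewrite -lee_fin -Mm.
have md : 0 < m + d by rewrite ltr_wpDl.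
exists (m + d); last by rewrite Mm.
split=> // u uw phi; rewrite (aniso_sumE q le_rs).
(* A zero [phi] cannot be normalised, but then both sides vanish. *)
have [phi0|phi0] := eqVneq (rnorm phi) 0.
  rewrite phi0 mule0 mul0e.
  rewrite (rnorm_eq0 phi0) -(scale0r phi) (Psi_enormZl q_ge1).
  by rewrite rnorm0 mul0e.
have t0 : 0 < rnorm phi by rewrite lt_def phi0 rnorm_ge0.
set t := rnorm phi in phi0 t0 *.
have nt : rnorm (of_real k t^-1 : K^o) = t^-1.
  by rewrite rnorm_of_real// invr_ge0 ltW.
have : (pi_norm q p (clin_comp (Psi le_rs (of_real k t^-1 *: phi)) T) < (m + d)%:E)%E.
  rewrite (@le_lt_trans _ _ M)//; last by rewrite Mm lte_fin ltrDl.
  apply: ereal_sup_ubound; exists (of_real k t^-1 *: phi) => //=.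
  by rewrite rnormZ nt mulVf.
(* The constant [C] depends on [phi] but stays below [m + d]; undoing the normalisation multiplies
   it by [t]. *)
move=> /ereal_inf_lt[_ [C /= [C0 /(_ _ uw) TC] <-]]; rewrite lte_fin => Cmd.
move: TC; rewrite /= (Psi_enormZl q_ge1) nt lee_pdivrMl// => /le_trans; apply.
rewrite (muleC (m + d)%:E) -muleA lee_wpmul2l ?lee_fin ?(ltW t0)//.
by rewrite lee_wpmul2r ?weak_enorm_ge0// lee_fin ltW.
Qed.
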